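(* Let $g:\mathcal{X}\to\mathcal{Z}$ be one-to-one and onto, let $\mathbf{f}$ be linearly equivariant with respect to $g$ with nonsingular matrix $\mathbf{Q}_g$, i.e. $\mathbf{f}(g(\mathbf{x}))=\mathbf{Q}_g\mathbf{f}(\mathbf{x})$ for all $\mathbf{x}\in\mathcal{X}$, let $\tilde g(\boldsymbol\beta)=\mathbf{Q}_g^{-\mathsf T}\boldsymbol\beta$ for $\boldsymbol\beta\in\mathcal{B}$, and let $\mathcal{B}'\subseteq\mathcal{B}$. (a) If the design $\xi^*$ on $\mathcal{X}$ is maximin $D$-efficient on $\mathcal{B}'$, then the design $(\xi^* )^g$ on $\mathcal{Z}$ is maximin $D$-efficient on $\tilde{\mathcal{B}}'=\tilde g(\mathcal{B}')$. (b) Let $\nu$ be a probability measure on $\mathcal{X}$. If the design $\xi^*$ on $\mathcal{X}$ is maximin $IMSE$-efficient with respect to $\nu$ on $\mathcal{B}'$, then the design $(\xi^* )^g$ on $\mathcal{Z}$ is maximin $IMSE$-efficient with respect to the image measure $\nu^g$ on $\tilde{\mathcal{B}}'=\tilde g(\mathcal{B}')$.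
   Context: $\mathbf{f}$ is a vector of $p$ real regression functions defined on $\mathcal{X}$ and on $\mathcal{Z}$, with components linearly independent on $\mathcal{X}$; $\mathcal{B}\subseteq\mathbb{R}^p$ is the parameter region; $\lambda$ (the intensity function) is a positive real function defined on a set of reals containing all values $\mathbf{f}(\mathbf{x})^{\mathsf T}\boldsymbol\beta$, $\mathbf{x}\in\mathcal{X}$, $\boldsymbol\beta\in\mathcal{B}$; the same $\lambda$ is used on $\mathcal{Z}$. A design $\xi$ on a region is given by finitely many distinct support points $\mathbf{x}_i$ of the region and weights $w_i>0$, $\sum_i w_i=1$. Its information matrix is $\mathbf{M}(\xi;\boldsymbol\beta)=\sum_i w_i\,\lambda(\mathbf{f}(\mathbf{x}_i)^{\mathsf T}\boldsymbol\beta)\,\mathbf{f}(\mathbf{x}_i)\mathbf{f}(\mathbf{x}_i)^{\mathsf T}$. The image $\xi^g$ has support points $g(\mathbf{x}_i)$ and weights $w_i$; $\nu^g$ is the pushforward of $\nu$ under $g$. Homogeneous local $D$-criterion: $\Phi_{\boldsymbol\beta}(\xi)=\det(\mathbf{M}(\xi;\boldsymbol\beta))^{-1/p}$. Local $IMSE$-criterion with respect to $\nu$: $\Phi_{\boldsymbol\beta}(\xi)=\mathrm{trace}(\mathbf{V}(\boldsymbol\beta;\nu)\mathbf{M}(\xi;\boldsymbol\beta)^{-1})$, where $\mathbf{V}(\boldsymbol\beta;\nu)=\int\lambda(\mathbf{f}(\mathbf{x})^{\mathsf T}\boldsymbol\beta)^2\,\mathbf{f}(\mathbf{x})\mathbf{f}(\mathbf{x})^{\mathsf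 T}\,\nu(\mathrm{d}\mathbf{x})$. Both are $\infty$ for singular $\mathbf{M}(\xi;\boldsymbol\beta)$. For either criterion, let $\xi^*_{\boldsymbol\beta}$ be a locally optimal design at $\boldsymbol\beta$, i.e. a minimizer of $\Phi_{\boldsymbol\beta}$ over all designs on the region; it is assumed to exist for every $\boldsymbol\beta\in\mathcal{B}'$, with finite positive value $\Phi_{\boldsymbol\beta}(\xi^*_{\boldsymbol\beta})$. A design on the region is maximin $D$-efficient (resp. maximin $IMSE$-efficient with respect to $\nu$) on $\mathcal{B}'$ if it minimizes $\sup_{\boldsymbol\beta\in\mathcal{B}'}\Phi_{\boldsymbol\beta}(\xi)/\Phi_{\boldsymbol\beta}(\xi^*_{\boldsymbol\beta})$ over all designs $\xi$ on the region, for the corresponding criterion; for designs on $\mathcal{Z}$ the same definitions apply with $\tilde{\mathcal{B}}'$ and $\nu^g$. $\mathbf{f}$, $\lambda$, $g$, $g^{-1}$ are measurable and the integrals $\mathbf{V}$ are finite. $\mathbf{Q}^{-\mathsf T}$ denotes the inverse of the transpose of $\mathbf{Q}$. *)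

(* Defs.v *)
From HB Require Import structures.
From mathcomp Require Import all_boot all_order all_algebra.
From mathcomp Require Import all_classical all_reals all_analysis.
Set Implicit Arguments.
Unset Strict Implicit.
Unset Printing Implicit Defensive.
Import Order.TTheory GRing.Theory Num.Theory.
Local Open Scope classical_set_scope.
Local Open Scope ring_scope.

Record design (R : realType) (X : Type) := Design {
  dsize : nat;
  dpoint : 'I_dsize -> X;
  dweight : 'I_dsize -> R;
  dpoint_inj : injective dpoint;
  dweight_gt0 : forall i, 0 < dweight i;
  dweight_sum1 : \sum_i dweight i = 1 }.

(* Support points g x_i, same weights; injectivity of g keeps them distinct. *)
Definition design_image (R : realType) (X Z : Type) (g : X -> Z)
    (g_inj : injective g) (xi : design R X) : design R Z :=
  @Design R Z (dsize xi) (g \o @dpoint R X xi) (@dweight R X xi)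
    (inj_comp g_inj (@dpoint_inj R X xi))
    (@dweight_gt0 R X xi) (@dweight_sum1 R X xi).

(* Measurability of lam on a domain L that need not itself be measurable, i.e.
   with respect to the trace on L of the Borel sets.  (The library's
   measurable_fun L lam holds vacuously when L is not measurable.) *)
Definition measurable_on (R : realType) (L : set R) (lam : R -> R) : Prop :=
  forall Y : set R, measurable Y ->
    exists2 E : set R, measurable E & L `&` lam @^-1` Y = L `&` E.

Section Model.
Context (R : realType) (p : nat).

Definition linpred (X : Type) (f : X -> 'cV[R]_p) (beta : 'cV[R]_p) (x : X) : R :=
  ((f x)^T *m beta) 0 0.

Definition lin_indep (X : Type) (f : X -> 'cV[R]_p) : Prop :=
  forall c : 'cV[R]_p, (forall x, linpred f c x = 0) -> c = 0.

Definition infmx (X : Type) (f : X -> 'cV[R]_p) (lam : R -> R)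
    (xi : design R X) (beta : 'cV[R]_p) : 'M[R]_p :=
  \sum_(i < dsize xi)
    (dweight i * lam (linpred f beta (dpoint i))) *:
      (f (dpoint i) *m (f (dpoint i))^T).

Definition Vintegrand (X : Type) (f : X -> 'cV[R]_p) (lam : R -> R)
    (beta : 'cV[R]_p) (x : X) : 'M[R]_p :=
  (lam (linpred f beta x) ^+ 2) *: (f x *m (f x)^T).

Definition Vfinite d (X : measurableType d) (f : X -> 'cV[R]_p)
    (lam : R -> R) (nu : probability X R) (beta : 'cV[R]_p) : Prop :=
  forall i j, nu.-integrable [set: X] (fun x => (Vintegrand f lam beta x i j)%:E).

Definition Vmx d (X : measurableType d) (f : X -> 'cV[R]_p) (lam : R -> R)
    (nu : probability X R) (beta : 'cV[R]_p) : 'M[R]_p :=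
  \matrix_(i, j) \int[nu]_x (Vintegrand f lam beta x i j).

Definition Dcrit (X : Type) (f : X -> 'cV[R]_p) (lam : R -> R)
    (beta : 'cV[R]_p) (xi : design R X) : \bar R :=
  let M := infmx f lam xi beta in
  if M \in unitmx then ((\det M) `^ (- (p%:R)^-1))%:E else +oo%E.

Definition IMSEcrit d (X : measurableType d) (f : X -> 'cV[R]_p)
    (lam : R -> R) (nu : probability X R)
    (beta : 'cV[R]_p) (xi : design R X) : \bar R :=
  let M := infmx f lam xi beta in
  if M \in unitmx then (\tr (Vmx f lam nu beta *m invmx M))%:E else +oo%E.

Section Efficiency.
Context (X : Type) (Phi : 'cV[R]_p -> design R X -> \bar R).

Definition locally_optimal (beta : 'cV[R]_p) (xi : design R X) : Prop :=
  forall xi' : design R X, (Phi beta xi <= Phi beta xi')%E.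

Definition optimal_family (B : set 'cV[R]_p) (opt : 'cV[R]_p -> design R X) : Prop :=
  forall beta, B beta ->
    locally_optimal beta (opt beta) /\ (0 < Phi beta (opt beta) < +oo)%E.

Definition worst_ratio (B : set 'cV[R]_p) (opt : 'cV[R]_p -> design R X)
    (xi : design R X) : \bar R :=
  ereal_sup [set (Phi beta xi / Phi beta (opt beta))%E | beta in B].

(* The assumed existence of locally optimal designs, with finite positive
   criterion value, is part of the notion.  The choice of opt is immaterial:
   any two families have the same values Phi beta (opt beta) on B. *)
Definition maximin_efficient (B : set 'cV[R]_p) (xi : design R X) : Prop :=
  exists2 opt : 'cV[R]_p -> design R X, optimal_family B opt &
    forall xi' : design R X, (worst_ratio B opt xi <= worst_ratio B opt xi')%E.

End Efficiency.

Definition maximin_Defficient (X : Type) (f : X -> 'cV[R]_p) (lam : R -> R) :=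
  maximin_efficient (Dcrit f lam).

Definition maximin_IMSEefficient d (X : measurableType d) (f : X -> 'cV[R]_p)
    (lam : R -> R) (nu : probability X R) :=
  maximin_efficient (IMSEcrit f lam nu).

Definition gtilde (Q : 'M[R]_p) (beta : 'cV[R]_p) : 'cV[R]_p :=
  invmx (Q^T) *m beta.

Definition linearly_equivariant (X Z : Type) (fX : X -> 'cV[R]_p)
    (fZ : Z -> 'cV[R]_p) (g : X -> Z) (Q : 'M[R]_p) : Prop :=
  forall x, fZ (g x) = Q *m fX x.

End Model.

(* Main.v *)
(** The map [g] transports designs bijectively from [X] to [Z], and the
    parameter change [gtilde] leaves the linear predictor unchanged, so the
    information matrix becomes [Q M Q^T].  Hence the local [D]-criterion is
    multiplied by the constant [(det Q ^ 2)^(-1/p)], while the [IMSE]-criterion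
    is unchanged because [V] transforms in the same way as [M].  Both factors
    cancel in the efficiency ratios. *)
Require Import Defs.
From HB Require Import structures.
From mathcomp Require Import all_boot all_order all_algebra.
From mathcomp Require Import all_classical all_reals all_analysis.
From mathcomp Require Import measurable_realfun.
Set Implicit Arguments.
Unset Strict Implicit.
Unset Printing Implicit Defensive.
Import Order.TTheory GRing.Theory Num.Theory.
Local Open Scope classical_set_scope.
Local Open Scope ring_scope.

Lemma invmx_mulmx (R : comUnitRingType) (n : nat) (A B : 'M[R]_n) :
  A \in unitmx -> B \in unitmx -> invmx (A *m B) = invmx B *m invmx A.
Proof.
move=> uA uB; have uAB : A *m B \in unitmx by rewrite unitmx_mul uA.
apply: (can_inj (mulKmx uAB)).
by rewrite mulmxV// -mulmxA mulKVmx// mulmxV.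
Qed.

(** The factors [Q^T] cancel inside the product, and the remaining conjugation by [Q] disappears by
    cyclicity of the trace. *)
Lemma mxtrace_congruence (R : comUnitRingType) (n : nat) (Q V M : 'M[R]_n) :
  Q \in unitmx -> M \in unitmx ->
  \tr ((Q *m V *m Q^T) *m invmx (Q *m M *m Q^T)) = \tr (V *m invmx M).
Proof.
move=> uQ uM; have uQT : Q^T \in unitmx by rewrite unitmx_tr.
rewrite !invmx_mulmx ?unitmx_mul ?uQ// !mulmxA mulmxK//.
by rewrite mxtrace_mulC !mulmxA mulVmx// mul1mx.
Qed.

Lemma sqr_det_gt0 (R : realFieldType) (n : nat) (Q : 'M[R]_n) :
  Q \in unitmx -> 0 < \det Q ^+ 2.
Proof. by rewrite unitmxE unitfE lt_def sqr_ge0 andbT sqrf_eq0. Qed.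

Lemma sqr_row_gt0 (R : realDomainType) (n : nat) (v : 'rV[R]_n) :
  v != 0 -> 0 < (v *m v^T) 0 0.
Proof.
have -> : (v *m v^T) 0 0 = \sum_j v 0 j ^+ 2.
  by rewrite !mxE; apply: eq_bigr => j _; rewrite mxE.
move=> v0; rewrite lt_neqAle sumr_ge0 ?andbT => [|j _]; last exact: sqr_ge0.
rewrite eq_sym psumr_eq0 => [|j _]; last exact: sqr_ge0.
apply: contra v0 => /allP v0; apply/eqP/rowP => j.
by move/(_ j (mem_index_enum j)): v0; rewrite sqrf_eq0 mxE => /eqP.
Qed.

(* On the segment from [M] to the identity every matrix except possibly [M]
   is positive definite, so the determinant cannot change sign. *)
Lemma det_psd_ge0 (R : rcfType) (n : nat) (M : 'M[R]_n) :
  (forall v : 'rV_n, 0 <= (v *m M *m v^T) 0 0) -> 0 <= \det M.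
Proof.
move=> M_ge0; rewrite leNgt; apply/negP => detM_lt0.
(* Along the segment the determinant is a polynomial in the parameter, so a sign change forces a
   root in the unit interval. *)
pose P : {poly R} := \det ((1 - 'X) *: map_mx polyC M + 'X%:M).
have PE t : P.[t] = \det ((1 - t) *: M + t%:M).
  rewrite -horner_evalE /P -det_map_mx; congr (\det _).
  apply/matrixP => i j; rewrite !mxE /= horner_evalE !hornerE.
  by rewrite hornerMn hornerX.
have [|t /andP[t_ge0 t_le1]] := @poly_ivt R P 0 1 ler01.
  rewrite !PE subr0 scale1r raddf0 addr0 (ltW detM_lt0)/=.
  by rewrite subrr scale0r add0r det1 ler01.
rewrite rootE PE => detN; have [t0|t0] := eqVneq t 0.
  move: detN; rewrite t0 subr0 scale1r raddf0 addr0 => /eqP detM0.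
  by rewrite detM0 ltxx in detM_lt0.
have t_gt0 : 0 < t by rewrite lt_neqAle eq_sym t0.
(* A kernel vector makes the quadratic form vanish, yet the identity part contributes a positive
   term since [t] is positive. *)
have [v v0 vN] := det0P detN.
have : 0 < (v *m ((1 - t) *: M + t%:M) *m v^T) 0 0.
  rewrite mulmxDr mulmxDl -scalemxAr -scalemxAl mul_mx_scalar -scalemxAl !mxE.
  have {}M_ge0 := M_ge0 v; have := sqr_row_gt0 v0; rewrite !mxE in M_ge0 * => ?.
  by rewrite ltr_wpDl ?mulr_gt0// mulr_ge0// subr_ge0.
by rewrite vN mul0mx mxE ltxx.
Qed.

(** Lets an arbitrary competitor on [Z] be replaced by the image of a design on [X]. *)
Lemma design_image_surj (R : realType) (X Z : Type) (g : X -> Z)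
    (ginv : Z -> X) (gK : cancel g ginv) (ginvK : cancel ginv g)
    (xi : design R Z) :
  design_image (can_inj gK) (design_image (can_inj ginvK) xi) = xi.
Proof.
case: xi => n pt w pt_inj w_gt0 w_sum; rewrite /design_image/=.
have ptE : g \o (ginv \o pt) = pt by apply/funext => i /=; rewrite ginvK.
(* The type of the injectivity proof mentions the point map, so the proof is generalized before that
   map is rewritten. *)
move: (inj_comp _ _); rewrite /= ptE => pt_inj'.
by congr Design; exact: Prop_irrelevance.
Qed.

(** Only the denominator has to be finite and positive: [x] may be infinite, as it is for a singular
    information matrix. *)
Lemma ediv_pmul2l (R : realFieldType) (c : R) (x y : \bar R) :
  (0 < c)%R -> (0 < y < +oo)%E -> (c%:E * x / (c%:E * y) = x / y)%E.
Proof.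
move=> c0; case: y => [r| |] //=; last by rewrite ltxx andbF.
rewrite lte_fin => /andP[r0 _].
rewrite inveM; last by rewrite fin_inveM_def// eqe gt_eqF.
by rewrite muleACA divee ?mul1e// eqe gt_eqF.
Qed.

Section Transport.
Context (R : realType) (p : nat) (X Z : Type) (g : X -> Z) (ginv : Z -> X).
Hypotheses (gK : cancel g ginv) (ginvK : cancel ginv g).
Local Notation image xi := (design_image (can_inj gK) xi).

Section Efficiency.
Context (PhiX : 'cV[R]_p -> design R X -> \bar R).
Context (PhiZ : 'cV[R]_p -> design R Z -> \bar R).
Context (h h' : 'cV[R]_p -> 'cV[R]_p) (hK : cancel h h').
Context (B : set 'cV[R]_p) (c : 'cV[R]_p -> R).
Hypothesis c_gt0 : forall beta, B beta -> 0 < c beta.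
Hypothesis Phi_image : forall beta xi, B beta ->
  PhiZ (h beta) (image xi) = ((c beta)%:E * PhiX beta xi)%E.

(** The factor [c beta] does not depend on the design, so it cancels in each ratio; the two suprema
    then run over the same values. *)
Lemma worst_ratio_image (opt : 'cV[R]_p -> design R X) (xi : design R X) :
  optimal_family PhiX B opt ->
  worst_ratio PhiZ (h @` B) (fun beta => image (opt (h' beta))) (image xi) =
  worst_ratio PhiX B opt xi.
Proof.
move=> optP; rewrite /worst_ratio image_comp; congr ereal_sup.
apply: eq_imagel => beta Bbeta /=; rewrite hK !Phi_image//.
by apply: ediv_pmul2l; [exact: c_gt0|have [] := optP _ Bbeta].
Qed.

Lemma maximin_efficient_image (xi : design R X) :
  maximin_efficient PhiX B xi -> maximin_efficient PhiZ (h @` B) (image xi).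
Proof.
move=> [opt optP xi_opt].
(* Local optima on [Z] are images of those on [X], taken at the parameter pulled back by [h']. *)
exists (fun beta => image (opt (h' beta))) => [_ [beta Bbeta <-]|xi'].
  have [optB /andP[opt_gt0 opt_lty]] := optP _ Bbeta.
  rewrite hK Phi_image//; split=> [xi'|].
    rewrite -(design_image_surj gK ginvK xi') !Phi_image//.
    by rewrite lee_pmul2l ?lte_fin ?c_gt0.
  by rewrite mule_gt0 ?lte_fin ?c_gt0// lte_mul_pinfty ?lee_fin ?ltW ?c_gt0.
by rewrite -(design_image_surj gK ginvK xi') !worst_ratio_image.
Qed.

End Efficiency.

Context (fX : X -> 'cV[R]_p) (fZ : Z -> 'cV[R]_p) (lam : R -> R) (Q : 'M[R]_p).
Hypotheses (Q_unit : Q \in unitmx) (f_equiv : linearly_equivariant fX fZ g Q).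

Lemma gtildeK : cancel (gtilde Q) (mulmx Q^T).
Proof. by move=> beta; rewrite /gtilde mulKVmx ?unitmx_tr. Qed.

(** The [Q^T] coming from the regression vector cancels the inverse transpose in [gtilde], so [lam]
    is evaluated at the same point. *)
Lemma linpred_gtilde (beta : 'cV[R]_p) (x : X) :
  linpred fZ (gtilde Q beta) (g x) = linpred fX beta x.
Proof.
by rewrite /linpred /gtilde f_equiv trmx_mul -mulmxA mulKVmx ?unitmx_tr.
Qed.

Lemma infmx_image (beta : 'cV[R]_p) (xi : design R X) :
  infmx fZ lam (image xi) (gtilde Q beta) = Q *m infmx fX lam xi beta *m Q^T.
Proof.
rewrite /infmx mulmx_sumr mulmx_suml; apply: eq_bigr => i _ /=.
by rewrite linpred_gtilde f_equiv trmx_mul -scalemxAr -scalemxAl !mulmxA.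
Qed.

Lemma Vintegrand_gtilde (beta : 'cV[R]_p) (x : X) :
  Vintegrand fZ lam (gtilde Q beta) (g x) =
  Q *m Vintegrand fX lam beta x *m Q^T.
Proof.
rewrite /Vintegrand linpred_gtilde f_equiv trmx_mul.
by rewrite -scalemxAr -scalemxAl !mulmxA.
Qed.

(** The quadratic form of the information matrix is a nonnegative combination of squares. The sign
    is needed to split a real power of a product of determinants. *)
Lemma det_infmx_ge0 (beta : 'cV[R]_p) (xi : design R X) :
  (forall x, 0 <= lam (linpred fX beta x)) -> 0 <= \det (infmx fX lam xi beta).
Proof.
move=> lam_ge0; apply: det_psd_ge0 => v.
rewrite /infmx mulmx_sumr mulmx_suml summxE; apply: sumr_ge0 => i _.
rewrite -scalemxAr -scalemxAl mxE.
apply: mulr_ge0; first by rewrite mulr_ge0// ltW// dweight_gt0.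
set u := fX _; have -> : v *m (u *m u^T) *m v^T = (v *m u) *m (v *m u)^T.
  by rewrite trmx_mul !mulmxA.
by rewrite mxE big_ord1 [X in _ * X]mxE -expr2 sqr_ge0.
Qed.

Lemma unitmx_infmx_image (beta : 'cV[R]_p) (xi : design R X) :
  (infmx fZ lam (image xi) (gtilde Q beta) \in unitmx) =
  (infmx fX lam xi beta \in unitmx).
Proof. by rewrite infmx_image !unitmx_mul unitmx_tr Q_unit andbT. Qed.

Lemma Dcrit_image (beta : 'cV[R]_p) (xi : design R X) :
  (forall x, 0 <= lam (linpred fX beta x)) ->
  Dcrit fZ lam (gtilde Q beta) (image xi) =
  (((\det Q ^+ 2) `^ (- (p%:R)^-1))%:E * Dcrit fX lam beta xi)%E.
Proof.
move=> lam_ge0; rewrite /Dcrit unitmx_infmx_image; case: ifP => _; last first.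
  (* In the singular case both sides are infinite, because the factor is positive. *)
  by rewrite gt0_muley// lte_fin powR_gt0 ?sqr_det_gt0.
rewrite -EFinM -powRM ?sqr_ge0 ?det_infmx_ge0//; congr ((_ `^ _)%:E).
by rewrite infmx_image !det_mulmx det_tr mulrAC expr2.
Qed.

End Transport.

Section IMSE.
Context (R : realType) (p : nat) (dX dZ : measure_display).
Context (X : measurableType dX) (Z : measurableType dZ).
Context (fX : X -> 'cV[R]_p) (fZ : Z -> 'cV[R]_p) (lam : R -> R).
Context (g : {mfun X >-> Z}) (ginv : {mfun Z >-> X}).
Hypotheses (gK : cancel g ginv) (ginvK : cancel ginv g).
Context (Q : 'M[R]_p).
Hypotheses (Q_unit : Q \in unitmx) (f_equiv : linearly_equivariant fX fZ g Q).
Context (nu : probability X R) (beta : 'cV[R]_p).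
Hypothesis V_finite : Vfinite fX lam nu beta.

(* Measurability of the integrand on [Z] is that of the integrand on [X],
   composed with [ginv]. *)
Lemma Vmx_distribution :
  Vmx fZ lam (distribution nu g) (gtilde Q beta) =
  Q *m Vmx fX lam nu beta *m Q^T.
Proof.
apply/matrixP => i j.
have VE x : Vintegrand fZ lam (gtilde Q beta) (g x) i j =
    \sum_b \sum_a Q i a * Q j b * Vintegrand fX lam beta x a b.
  rewrite (Vintegrand_gtilde _ Q_unit f_equiv) mxE; apply: eq_bigr => b _.
  by rewrite !mxE mulr_suml; apply: eq_bigr => a _; rewrite mulrAC.
have V_int a b :
    nu.-integrable setT
      (fun x => (Q i a * Q j b * Vintegrand fX lam beta x a b)%:E).
  by under eq_fun do rewrite EFinM; exact: integrableZl.
(* The transported integrand as a finite sum of integrable terms, which gives its integrability and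
   allows termwise integration. *)
pose V (x : X) : \bar R :=
  (\sum_b \sum_a (Q i a * Q j b * Vintegrand fX lam beta x a b)%:E)%E.
have VgE x : (Vintegrand fZ lam (gtilde Q beta) (g x) i j)%:E = V x.
  by rewrite VE -sumEFin; apply: eq_bigr => b _; rewrite sumEFin.
have V_int' : nu.-integrable setT V.
  by apply: integrable_sum => // b _; exact: integrable_sum.
rewrite mxE /Rintegral integral_distribution; first last.
- by apply: eq_integrable V_int' => // x _; rewrite /= VgE.
- have -> : (fun z => (Vintegrand fZ lam (gtilde Q beta) z i j)%:E) = V \o ginv.
    by apply/funext => z; rewrite /= -VgE ginvK.
  by apply: measurableT_comp => //; exact: measurable_int V_int'.
under eq_integral do rewrite /= VgE.
rewrite integral_sum// => [|b]; last exact: integrable_sum.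
(* The real entry is lifted to the extended reals, where both sides can be compared term by term;
   integrability makes each integral finite. *)
rewrite [RHS]mxE -[RHS]/(fine (EFin _)) -sumEFin; congr fine.
apply: eq_bigr => b _.
rewrite integral_sum// [in RHS]mxE mulr_suml -sumEFin; apply: eq_bigr => a _.
under eq_integral do rewrite EFinM.
rewrite integralZl// !mxE mulrAC [in RHS]EFinM /Rintegral fineK//.
exact: integrable_fin_num.
Qed.

Lemma IMSEcrit_image (xi : design R X) :
  IMSEcrit fZ lam (distribution nu g) (gtilde Q beta)
    (design_image (can_inj gK) xi) = IMSEcrit fX lam nu beta xi.
Proof.
rewrite /IMSEcrit (unitmx_infmx_image _ _ Q_unit f_equiv).
case: ifPn => // M_unit.
by rewrite (infmx_image _ _ Q_unit f_equiv) Vmx_distribution mxtrace_congruence.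
Qed.

End IMSE.

Theorem corollary4 (R : realType) (p : nat) (p_gt0 : (0 < p)%N)
  (dX dZ : measure_display) (X : measurableType dX) (Z : measurableType dZ)
  (fX : X -> 'cV[R]_p) (fZ : Z -> 'cV[R]_p)
  (fX_meas : forall i, measurable_fun [set: X] (fun x => fX x i 0))
  (fZ_meas : forall i, measurable_fun [set: Z] (fun z => fZ z i 0))
  (fX_indep : lin_indep fX)
  (B : set 'cV[R]_p)
  (L : set R) (lam : R -> R)
  (L_linpred : forall x beta, B beta -> L (linpred fX beta x))
  (lam_gt0 : forall t, L t -> 0 < lam t)
  (lam_meas : measurable_on L lam)
  (g : {mfun X >-> Z}) (ginv : {mfun Z >-> X})
  (gK : cancel g ginv) (ginvK : cancel ginv g)
  (Q : 'M[R]_p) (Q_unit : Q \in unitmx)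
  (f_equiv : linearly_equivariant fX fZ g Q)
  (B' : set 'cV[R]_p) (B'B : B' `<=` B) :
  (forall xi : design R X,
     maximin_Defficient fX lam B' xi ->
     maximin_Defficient fZ lam (gtilde Q @` B')
       (design_image (can_inj gK) xi))
  /\
  (forall nu : probability X R,
     (forall beta, B' beta -> Vfinite fX lam nu beta) ->
     forall xi : design R X,
       maximin_IMSEefficient fX lam nu B' xi ->
       maximin_IMSEefficient fZ lam (distribution nu g) (gtilde Q @` B')
         (design_image (can_inj gK) xi)).
Proof.
split=> [xi|nu V_finite xi].
  (* The factor comes from the two determinants of [Q] in the congruence, raised to the exponent of
     the criterion. *)
  apply: (maximin_efficient_image ginvK (gtildeK Q_unit)
    (c := fun=> (\det Q ^+ 2) `^ (- (p%:R)^-1))) => [beta _|beta xi' B'beta].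
    by rewrite powR_gt0 ?sqr_det_gt0.
  apply: Dcrit_image => // x.
  by apply/ltW/lam_gt0/L_linpred/B'B.
apply: (maximin_efficient_image ginvK (gtildeK Q_unit) (c := fun=> 1)) => //.
move=> beta xi' B'beta; rewrite mul1e; apply: IMSEcrit_image => //.
exact: V_finite.
Qed.
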